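(* Let $\mathbb{H}=\{z\in\mathbb{C} : \operatorname{Im} z>0\}$. For every holomorphic mapping $f:\mathbb{H}\to\mathbb{H}$ and all $z,w\in\mathbb{H}$, $$ j_{\mathbb{H}}(f(z),f(w))\le 2\, j_{\mathbb{H}}(z,w). $$ Moreover, the constant $2$ is best possible, i.e. there is no constant $C<2$ such that $j_{\mathbb{H}}(f(z),f(w))\le C\, j_{\mathbb{H}}(z,w)$ holds for all holomorphic $f:\mathbb{H}\to\mathbb{H}$ and all $z,w\in\mathbb{H}$.
   Context: For a proper subdomain $G\subset\mathbb{R}^n$ (with $\mathbb{C}$ identified with $\mathbb{R}^2$) the distance ratio metric $j_G$ is defined for $x,y\in G$ by $$ j_G(x,y)=\log\left(1+\frac{|x-y|}{\min\{d(x,\partial G),d(y,\partial G)\}}\right), $$ where $d(x,\partial G)$ denotes the Euclidean distance from $x$ to the boundary $\partial G$. In particular, for the upper half-plane $\mathbb{H}$, $d(z,\partial\mathbb{H})=\operatorname{Im} z$, so $j_{\mathbb{H}}(z,w)=\log\left(1+\frac{|z-w|}{\min\{\operatorname{Im} z,\operatorname{Im} w\}}\right)$. *)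

(* Defs.v *)
From Stdlib Require Import Reals.
From Coquelicot Require Import Coquelicot.

Open Scope R_scope.

Definition boundary {T : UniformSpace} (G : T -> Prop) (x : T) : Prop :=
  ~ locally x G /\ ~ locally x (fun y => ~ G y).

(* [Glb_Rbar] is an extended real, equal to +oo on the empty set, and [real]
   sends infinities to 0: the value is the true distance whenever [S] is
   nonempty, as is the boundary of any nonempty proper subset of C. *)
Definition dist_to (S : C -> Prop) (z : C) : R :=
  real (Glb_Rbar (fun r => exists s : C, S s /\ r = Cmod (z - s)%C)).

Definition distance_ratio (G : C -> Prop) (z w : C) : R :=
  ln (1 + Cmod (z - w)%C /
          Rmin (dist_to (boundary G) z) (dist_to (boundary G) w)).

Definition upper_half_plane (z : C) : Prop := 0 < Im z.

(* The structures are given explicitly because C also carries a real normed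
   module structure; over [C_AbsRing] this is complex differentiability. *)
Definition holomorphic_on (G : C -> Prop) (f : C -> C) : Prop :=
  forall z : C, G z -> @ex_derive C_AbsRing C_NormedModule f z.

(* A map G -> H is represented by a total function C -> C whose values outside
   G are irrelevant. *)
Definition holomorphic_map (G H : C -> Prop) (f : C -> C) : Prop :=
  holomorphic_on G f /\ (forall z : C, G z -> H (f z)).

(* Main.v *)
Require Import Defs.
From Stdlib Require Import Reals.
From Stdlib Require Import Lra Lia Classical ClassicalEpsilon.
From Coquelicot Require Import Coquelicot.

(** Schwarz-Pick in the half-plane reads |f z - f w| / |f z - conj (f w)| <=
    |z - w| / |z - conj w|.  Squaring and using |z - conj w|^2 = |z - w|^2 + 4 Im z Im w, the
    numbers t = |z - w| / min (Im z, Im w) and t' (the same for f z, f w) satisfy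
    t'^2 <= t^2 (1 + t'), which forces 1 + t' <= (1 + t)^2.  Sharpness comes from
    f u = -1/u with z = i and w = -T + i, T -> +oo.

    Schwarz-Pick is the maximum principle for
    F y = (f y - f w) (y - conj w) / ((y - w) (f y - conj (f w))) on the pseudo-hyperbolic discs
    |y - w| <= r |y - conj w|, r -> 1.  The maximum principle is deduced from the mean value
    property, which follows from Goursat's bisection argument applied to F (z1 + rho exp y) on
    squares of side 2 pi: by periodicity the horizontal sides cancel, so the average over the
    circle of radius rho e^x does not depend on x.  This needs nothing but continuity of F at
    the centre z1. *)

Open Scope R_scope.

(** * Bisection of squares *)

(** A square violating [P] has a quarter violating [P]; the successive quarters shrink to a common
    point, where the local hypothesis applies and gives a contradiction. The principle serves both
    Goursat's estimate and compactness. *)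
Lemma square_induction (P : R -> R -> R -> Prop) (x0 y0 s0 : R) :
  0 < s0 ->
  (forall x y h, 0 < h -> P x y h -> P (x + h) y h -> P x (y + h) h ->
     P (x + h) (y + h) h -> P x y (2 * h)) ->
  (forall p q, x0 <= p <= x0 + s0 -> y0 <= q <= y0 + s0 ->
     exists d, 0 < d /\ forall x y h, 0 < h < d -> x <= p <= x + h ->
       y <= q <= y + h -> P x y h) ->
  P x0 y0 s0.
Proof.
intros Hs Hsplit Hloc.
destruct (classic (P x0 y0 s0)) as [H|Hbad]; [exact H|exfalso].
(* The properties of [c'] are conditional on [c] being bad, so that choice yields a total function
   on triples. *)
assert (Hstep : forall c : R * R * R, exists c' : R * R * R,
  0 < snd c -> ~ P (fst (fst c)) (snd (fst c)) (snd c) ->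
  ~ P (fst (fst c')) (snd (fst c')) (snd c') /\
  snd c' = snd c / 2 /\
  fst (fst c) <= fst (fst c') <= fst (fst c) + snd c / 2 /\
  snd (fst c) <= snd (fst c') <= snd (fst c) + snd c / 2).
{ intros [[x y] s]; simpl.
  destruct (classic (0 < s /\ ~ P x y s)) as [[H0 H]|H];
    [|exists (x, y, s); intros; tauto].
  destruct (classic (P x y (s/2))) as [H1|H1];
    [|exists (x, y, s/2); simpl; intros; repeat split; auto; lra].
  destruct (classic (P (x+s/2) y (s/2))) as [H2|H2];
    [|exists (x+s/2, y, s/2); simpl; intros; repeat split; auto; lra].
  destruct (classic (P x (y+s/2) (s/2))) as [H3|H3];
    [|exists (x, y+s/2, s/2); simpl; intros; repeat split; auto; lra].
  destruct (classic (P (x+s/2) (y+s/2) (s/2))) as [H4|H4];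
    [|exists (x+s/2, y+s/2, s/2); simpl; intros; repeat split; auto; lra].
  exfalso; apply H; replace s with (2 * (s/2)) by lra.
  apply Hsplit; auto; lra. }
destruct (ChoiceFacts.constructive_indefinite_descr_fun_choice
  constructive_indefinite_description _ Hstep) as [next Hnext].
set (c := fun n : nat => Nat.iter n next (x0, y0, s0)).
set (x n := fst (fst (c n))); set (y n := snd (fst (c n))).
assert (Hc : forall n, ~ P (x n) (y n) (s0 / 2 ^ n) /\ snd (c n) = s0 / 2 ^ n).
{ induction n as [|n [IH1 IH2]].
  - simpl; split; [unfold Rdiv; rewrite Rinv_1, Rmult_1_r; exact Hbad|].
    unfold c; simpl; lra.
  - assert (H2n : 0 < s0 / 2 ^ n)
      by (apply Rdiv_lt_0_compat; [lra|apply pow_lt; lra]).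
    destruct (Hnext (c n)) as (A1 & A2 & _); [rewrite IH2; auto|rewrite IH2; exact IH1|].
    change (next (c n)) with (c (S n)) in A1, A2.
    assert (E : snd (c (S n)) = s0 / 2 ^ S n).
    { rewrite A2, IH2; simpl; field; apply pow_nonzero; lra. }
    split; [rewrite <- E; exact A1|exact E]. }
assert (Hpos : forall n, 0 < s0 / 2 ^ n)
  by (intros n; apply Rdiv_lt_0_compat; [lra|apply pow_lt; lra]).
assert (Hmon : forall n, x n <= x (S n) <= x n + s0 / 2 ^ n / 2 /\
                         y n <= y (S n) <= y n + s0 / 2 ^ n / 2).
{ intros n; destruct (Hc n) as [C1 C2].
  destruct (Hnext (c n)) as (_ & _ & A3 & A4);
    [rewrite C2; auto|rewrite C2; exact C1|].
  rewrite C2 in A3, A4; split; [exact A3|exact A4]. }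
(* The subtracted term expresses that the right and upper ends decrease, that is, that the squares
   are nested. *)
assert (Htail : forall n k, x n <= x (n + k)%nat <= x n + s0 / 2 ^ n - s0 / 2 ^ (n + k) /\
                            y n <= y (n + k)%nat <= y n + s0 / 2 ^ n - s0 / 2 ^ (n + k)).
{ intros n; induction k as [|k IH].
  - rewrite Nat.add_0_r; lra.
  - rewrite Nat.add_succ_r; specialize (Hmon (n + k)%nat).
    replace (s0 / 2 ^ S (n + k)) with (s0 / 2 ^ (n + k) / 2)
      by (simpl; field; apply pow_nonzero; lra).
    lra. }
assert (Hlim : forall u : nat -> R,
  (forall n k, u n <= u (n + k)%nat <= u n + s0 / 2 ^ n - s0 / 2 ^ (n + k)) ->
  exists p, forall n, u n <= p <= u n + s0 / 2 ^ n).
{ intros u Hu.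
  (* Every left end lies below every right end, so the supremum of the left ends belongs to all the
     intervals. *)
  assert (B : forall m n, u m <= u n + s0 / 2 ^ n).
  { intros m n; destruct (Nat.le_ge_cases m n) as [L|L].
    - destruct (Hu m (n - m)%nat) as [U _].
      replace (m + (n - m))%nat with n in U by lia.
      specialize (Hpos n); lra.
    - destruct (Hu n (m - n)%nat) as [_ U].
      replace (n + (m - n))%nat with m in U by lia.
      specialize (Hpos m); lra. }
  destruct (completeness (fun r => exists n, r = u n)) as [p [Hp1 Hp2]].
  - exists (u 0%nat + s0 / 2 ^ 0); intros r [n ->]; apply B.
  - exists (u 0%nat), 0%nat; reflexivity.
  - exists p; intros n; split; [apply Hp1; exists n; reflexivity|].
    apply Hp2; intros r [m ->]; apply B. }
destruct (Hlim x) as [p Hp]; [intros; apply Htail|].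
destruct (Hlim y) as [q Hq]; [intros; apply Htail|].
assert (Ex : x 0%nat = x0) by reflexivity.
assert (Ey : y 0%nat = y0) by reflexivity.
destruct (Hloc p q) as (d & Hd & Hloc').
- generalize (Hp 0%nat); rewrite Ex; simpl; lra.
- generalize (Hq 0%nat); rewrite Ey; simpl; lra.
- destruct (pow_lt_1_zero (/2)) with (y := d / s0) as [N HN].
  + rewrite Rabs_pos_eq; lra.
  + apply Rdiv_lt_0_compat; lra.
  + apply (proj1 (Hc N)), Hloc'; [split; auto|apply Hp|apply Hq].
    specialize (HN N (Nat.le_refl N)).
    rewrite pow_inv, Rabs_pos_eq in HN
      by (left; apply Rinv_0_lt_compat, pow_lt; lra).
    replace d with (s0 * (d / s0)) by (field; lra).
    unfold Rdiv at 1; apply Rmult_lt_compat_l; auto.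
Qed.

(** * Complex differentiability *)

(* [Defs] uses [C_NormedModule] on the target; here the target carries the same
   structure as the source, as Coquelicot's product and chain rules over [C] require. *)
Notation Ccontinuous :=
  (@continuous (AbsRing_UniformSpace C_AbsRing) (AbsRing_UniformSpace C_AbsRing)).
Notation Cdifferentiable :=
  (@ex_derive C_AbsRing (AbsRing_NormedModule C_AbsRing)).

Lemma Clocally_iff (P : C -> Prop) (z : C) :
  @locally (AbsRing_UniformSpace C_AbsRing) z P <->
  exists d, 0 < d /\ forall y, Cmod (y - z) < d -> P y.
Proof.
split.
- intros [d Hd]; exists d; split; [apply cond_pos|exact Hd].
- intros (d & Hd & H); exists (mkposreal d Hd); exact H.
Qed.

Lemma Ccontinuous_iff (f : C -> C) (z : C) :
  Ccontinuous f z <->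
  forall e, 0 < e -> exists d, 0 < d /\
    forall y, Cmod (y - z) < d -> Cmod (f y - f z) < e.
Proof.
unfold continuous; rewrite filterlim_locally; split.
- intros H e He; apply (Clocally_iff (fun y => Cmod (f y - f z) < e)).
  exact (H (mkposreal e He)).
- intros H e; apply Clocally_iff; exact (H e (cond_pos e)).
Qed.

(** [is_derive] asks for its estimate at every limit of the filter [locally z]; by uniqueness of
    limits, [z] is the only one. *)
Lemma is_Cderive_iff (f : C -> C) (z l : C) :
  @is_derive C_AbsRing (AbsRing_NormedModule C_AbsRing) f z l <->
  forall e, 0 < e -> exists d, 0 < d /\
    forall y, Cmod (y - z) < d ->
      Cmod (f y - f z - (y - z) * l) <= e * Cmod (y - z).
Proof.
split.
- intros [_ H] e He.
  specialize (H z (fun P HP => HP) (mkposreal e He)).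
  apply Clocally_iff in H; exact H.
- intros H; split; [apply is_linear_scal_l|].
  intros x Hx.
  apply (is_filter_lim_locally_unique (K := C_AbsRing)
           (V := AbsRing_NormedModule C_AbsRing)) in Hx; subst x.
  intros e; apply Clocally_iff; exact (H e (cond_pos e)).
Qed.

Lemma ex_derive_Cdifferentiable (f : C -> C) (z : C) :
  @ex_derive C_AbsRing C_NormedModule f z -> Cdifferentiable f z.
Proof.
intros [l [_ H]]; exists l; apply is_Cderive_iff; intros e He.
specialize (H z (fun P HP => HP) (mkposreal e He)).
apply Clocally_iff in H; exact H.
Qed.

Lemma Cdifferentiable_ex_derive (f : C -> C) (z : C) :
  Cdifferentiable f z -> @ex_derive C_AbsRing C_NormedModule f z.
Proof.
intros [l H]; exists l; split; [apply is_linear_scal_l|].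
intros x Hx.
apply (is_filter_lim_locally_unique (K := C_AbsRing)
         (V := AbsRing_NormedModule C_AbsRing)) in Hx; subst x.
intros e; apply Clocally_iff.
exact (proj1 (is_Cderive_iff f z l) H e (cond_pos e)).
Qed.

Lemma Cdifferentiable_continuous (f : C -> C) (z : C) :
  Cdifferentiable f z -> Ccontinuous f z.
Proof. exact (@ex_derive_continuous C_AbsRing (AbsRing_NormedModule C_AbsRing) f z). Qed.

Lemma Cdifferentiable_mult (f g : C -> C) (z : C) :
  Cdifferentiable f z -> Cdifferentiable g z ->
  Cdifferentiable (fun y => f y * g y)%C z.
Proof.
intros [a Ha] [b Hb]; eexists.
apply (@is_derive_mult C_AbsRing f g z a b Ha Hb).
intros n m; apply Cmult_comm.
Qed.

Lemma Cdifferentiable_minus (f g : C -> C) (z : C) :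
  Cdifferentiable f z -> Cdifferentiable g z ->
  Cdifferentiable (fun y => f y - g y)%C z.
Proof. exact (@ex_derive_minus C_AbsRing (AbsRing_NormedModule C_AbsRing) f g z). Qed.

Lemma Cdifferentiable_plus (f g : C -> C) (z : C) :
  Cdifferentiable f z -> Cdifferentiable g z ->
  Cdifferentiable (fun y => f y + g y)%C z.
Proof. exact (@ex_derive_plus C_AbsRing (AbsRing_NormedModule C_AbsRing) f g z). Qed.

Lemma Cdifferentiable_const (a z : C) : Cdifferentiable (fun _ => a) z.
Proof. exact (@ex_derive_const C_AbsRing (AbsRing_NormedModule C_AbsRing) a z). Qed.

Lemma Cdifferentiable_id (z : C) : Cdifferentiable (fun y => y) z.
Proof. exact (@ex_derive_id C_AbsRing z). Qed.

Lemma Cdifferentiable_comp (f g : C -> C) (z : C) :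
  Cdifferentiable f (g z) -> Cdifferentiable g z ->
  Cdifferentiable (fun y => f (g y)) z.
Proof. exact (@ex_derive_comp C_AbsRing (AbsRing_NormedModule C_AbsRing) f g z). Qed.

Lemma Ccontinuous_mult (f g : C -> C) (z : C) :
  Ccontinuous f z -> Ccontinuous g z -> Ccontinuous (fun y => f y * g y)%C z.
Proof. exact (@continuous_mult (AbsRing_UniformSpace C_AbsRing) C_AbsRing f g z). Qed.

Lemma Ccontinuous_plus (f g : C -> C) (z : C) :
  Ccontinuous f z -> Ccontinuous g z -> Ccontinuous (fun y => f y + g y)%C z.
Proof.
exact (@continuous_plus (AbsRing_UniformSpace C_AbsRing) C_AbsRing
         (AbsRing_NormedModule C_AbsRing) f g z).
Qed.

Lemma Cmod_minus_sym (a b : C) : Cmod (a - b) = Cmod (b - a).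
Proof. rewrite <- Cmod_opp; f_equal; ring. Qed.

(** The error of the linear approximation is (y - z)^2 / (y z^2). *)
Lemma Cdifferentiable_inv (z : C) : z <> 0 -> Cdifferentiable Cinv z.
Proof.
intros Hz; exists (- / (z * z))%C; apply is_Cderive_iff; intros e He.
assert (Hm : 0 < Cmod z) by (apply Cmod_gt_0; exact Hz).
set (m := Cmod z) in *.
assert (Hm3 : 0 < m ^ 3) by (apply pow_lt; exact Hm).
(* The first radius gives |y| > m / 2, hence |y z^2| >= m^3 / 2; with the second, the error is at
   most e |y - z|. *)
exists (Rmin (m / 2) (e * m ^ 3 / 2)); split.
{ apply Rmin_pos; [lra|]. apply Rdiv_lt_0_compat; [apply Rmult_lt_0_compat|]; lra. }
intros y Hy.
assert (H1 : Cmod (y - z) < m / 2) by (eapply Rlt_le_trans; [exact Hy|apply Rmin_l]).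
assert (H2 : Cmod (y - z) < e * m ^ 3 / 2) by (eapply Rlt_le_trans; [exact Hy|apply Rmin_r]).
assert (Hym : m / 2 < Cmod y).
{ generalize (Cmod_triangle y (z - y)); replace (y + (z - y))%C with z by ring.
  fold m; rewrite (Cmod_minus_sym z y); lra. }
assert (Hy0 : y <> 0) by (apply Cmod_gt_0; lra).
replace (/ y - / z - (y - z) * - / (z * z))%C
  with ((y - z) * (y - z) / (y * z * z))%C by (field; auto).
rewrite Cmod_div by (repeat apply Cmult_neq_0; auto).
rewrite !Cmod_mult; fold m.
set (k := Cmod (y - z)) in *; assert (0 <= k) by apply Cmod_ge_0.
assert (Hd : m ^ 3 / 2 <= Cmod y * m * m) by (simpl; nra).
assert (0 < Cmod y * m * m) by lra.
apply Rmult_le_reg_r with (Cmod y * m * m); [lra|].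
replace (k * k / (Cmod y * m * m) * (Cmod y * m * m)) with (k * k) by (field; lra).
replace (e * k * (Cmod y * m * m)) with (k * (e * (Cmod y * m * m))) by ring.
apply Rmult_le_compat_l; [lra|].
apply Rle_trans with (e * (m ^ 3 / 2)); [lra|].
apply Rmult_le_compat_l; lra.
Qed.

Lemma Rabs_le_Cmod (z : C) : Rabs (Re z) <= Cmod z /\ Rabs (Im z) <= Cmod z.
Proof.
generalize (Rmax_Cmod z); intros H; split;
  (eapply Rle_trans; [|exact H]); [apply Rmax_l|apply Rmax_r].
Qed.

Lemma Cmod_le_Rabs (z : C) : Cmod z <= Rabs (Re z) + Rabs (Im z).
Proof.
assert (E : (RtoC (Re z) + Ci * RtoC (Im z))%C = z)
  by (destruct z; apply injective_projections; simpl; ring).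
rewrite <- E at 1; eapply Rle_trans; [apply Cmod_triangle|].
rewrite Cmod_mult, Cmod_Ci, !Cmod_R; lra.
Qed.

(** * The complex exponential *)

Definition Cexp (z : C) : C := (exp (Re z) * cos (Im z), exp (Re z) * sin (Im z)).

Lemma Cexp_plus (a b : C) : Cexp (a + b) = (Cexp a * Cexp b)%C.
Proof.
unfold Cexp; rewrite re_plus, im_plus, exp_plus, cos_plus, sin_plus.
apply injective_projections; simpl; ring.
Qed.

Lemma Cmod_Cexp (z : C) : Cmod (Cexp z) = exp (Re z).
Proof.
unfold Cmod, Cexp; simpl fst; simpl snd.
replace ((exp (Re z) * cos (Im z)) ^ 2 + (exp (Re z) * sin (Im z)) ^ 2)
  with ((exp (Re z)) ^ 2 * (Rsqr (sin (Im z)) + Rsqr (cos (Im z))))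
  by (unfold Rsqr; ring).
rewrite sin2_cos2, Rmult_1_r; apply sqrt_pow2; left; apply exp_pos.
Qed.

Lemma derivable_pt_lim_expansion (f : R -> R) (l e : R) :
  derivable_pt_lim f 0 l -> 0 < e ->
  exists d, 0 < d /\ forall h, Rabs h < d -> Rabs (f h - f 0 - l * h) <= e * Rabs h.
Proof.
intros H He; destruct (H e He) as [d Hd]; exists d; split; [apply cond_pos|].
intros h Hh; destruct (Req_dec h 0) as [->|H0].
{ replace (f 0 - f 0 - l * 0) with 0 by ring; rewrite Rabs_R0; lra. }
specialize (Hd h H0 Hh); rewrite Rplus_0_l in Hd.
replace (f h - f 0 - l * h) with (((f h - f 0) / h - l) * h) by (field; auto).
rewrite Rabs_mult; apply Rmult_le_compat_r; [apply Rabs_pos|lra].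
Qed.

Lemma is_Cderive_exp_0 :
  @is_derive C_AbsRing (AbsRing_NormedModule C_AbsRing) Cexp (RtoC 0) (RtoC 1).
Proof.
apply is_Cderive_iff; intros e He.
(* The errors collected below add up to at most 7 e' |y|. *)
set (e' := Rmin 1 (e / 8)).
assert (He' : 0 < e' <= 1 /\ e' <= e / 8).
{ unfold e'; split; [split; [apply Rmin_pos; lra|apply Rmin_l]|apply Rmin_r]. }
destruct (derivable_pt_lim_expansion exp 1 e') as (d1 & Hd1 & E1);
  [rewrite <- exp_0; apply derivable_pt_lim_exp|tauto|].
destruct (derivable_pt_lim_expansion sin 1 e') as (d2 & Hd2 & E2);
  [rewrite <- cos_0; apply derivable_pt_lim_sin|tauto|].
destruct (derivable_pt_lim_expansion cos 0 e') as (d3 & Hd3 & E3);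
  [replace 0 with (- sin 0) at 2 by (rewrite sin_0; ring); apply derivable_pt_lim_cos|tauto|].
rewrite exp_0 in E1; rewrite sin_0 in E2; rewrite cos_0 in E3.
(* The bound |y| < e' makes the quadratic term a sin b at most 2 e' |y|. *)
exists (Rmin (Rmin d1 d2) (Rmin d3 e')); split.
{ repeat apply Rmin_pos; lra. }
intros y Hy.
replace (y - RtoC 0)%C with y in * by ring.
destruct (Rmin_Rgt_l _ _ _ Hy) as [H12 H3]; apply Rmin_Rgt_l in H12, H3.
destruct (Rabs_le_Cmod y) as [Ka Kb].
replace (Cexp (RtoC 0)) with (RtoC 1)
  by (unfold Cexp; simpl; rewrite exp_0, cos_0, sin_0, !Rmult_1_l; reflexivity).
eapply Rle_trans; [apply Cmod_le_Rabs|].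
destruct y as [a b]; unfold Cexp; simpl Re in *; simpl Im in *; simpl fst; simpl snd.
set (k := Cmod (a, b)) in *.
specialize (E1 a ltac:(lra)); specialize (E2 b ltac:(lra)); specialize (E3 b ltac:(lra)).
assert (A1 : Rabs (exp a - 1 - 1 * a) <= e' * k).
{ eapply Rle_trans; [exact E1|]; apply Rmult_le_compat_l; lra. }
assert (A2 : Rabs (sin b - 0 - 1 * b) <= e' * k).
{ eapply Rle_trans; [exact E2|]; apply Rmult_le_compat_l; lra. }
assert (A3 : Rabs (cos b - 1 - 0 * b) <= e' * k).
{ eapply Rle_trans; [exact E3|]; apply Rmult_le_compat_l; lra. }
assert (Hk : 0 <= k) by apply Cmod_ge_0.
assert (Hke : k < e') by lra.
replace (exp a * cos b + - (1) + - (a * 1 - b * 0))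
  with ((exp a - 1 - 1 * a) * cos b + (1 + a) * (cos b - 1 - 0 * b)) by ring.
replace (exp a * sin b + - 0 + - (a * 0 + b * 1))
  with ((exp a - 1 - 1 * a) * sin b + a * sin b + (sin b - 0 - 1 * b)) by ring.
generalize (COS_bound b) (SIN_bound b); intros Hcos Hsin.
assert (S1 : Rabs (sin b) <= 2 * k).
{ replace (sin b) with ((sin b - 0 - 1 * b) + b) by ring.
  eapply Rle_trans; [apply Rabs_triang|]. nra. }
assert (M1 : Rabs ((exp a - 1 - 1 * a) * cos b) <= e' * k).
{ rewrite Rabs_mult; assert (Rabs (cos b) <= 1) by (apply Rabs_le; lra).
  generalize (Rabs_pos (cos b)) (Rabs_pos (exp a - 1 - 1 * a)); nra. }
assert (M2 : Rabs ((1 + a) * (cos b - 1 - 0 * b)) <= 2 * (e' * k)).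
{ rewrite Rabs_mult; assert (Rabs (1 + a) <= 2)
    by (eapply Rle_trans; [apply Rabs_triang|]; rewrite Rabs_R1; lra).
  apply Rmult_le_compat; auto using Rabs_pos. }
assert (M3 : Rabs ((exp a - 1 - 1 * a) * sin b) <= e' * k).
{ rewrite Rabs_mult; assert (Rabs (sin b) <= 1) by (apply Rabs_le; lra).
  generalize (Rabs_pos (sin b)) (Rabs_pos (exp a - 1 - 1 * a)); nra. }
assert (M4 : Rabs (a * sin b) <= 2 * (e' * k)).
{ rewrite Rabs_mult; generalize (Rabs_pos a) (Rabs_pos (sin b)); intros.
  apply Rle_trans with (k * (2 * k)); [apply Rmult_le_compat; lra|nra]. }
apply Rle_trans with (7 * (e' * k)); [|nra].
generalize (Rabs_triang ((exp a - 1 - 1 * a) * cos b) ((1 + a) * (cos b - 1 - 0 * b)))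
  (Rabs_triang ((exp a - 1 - 1 * a) * sin b + a * sin b) (sin b - 0 - 1 * b))
  (Rabs_triang ((exp a - 1 - 1 * a) * sin b) (a * sin b)); lra.
Qed.

(** The functional equation carries the derivative at 0 to every point. *)
Lemma Cdifferentiable_exp (z : C) : Cdifferentiable Cexp z.
Proof.
apply (@ex_derive_ext C_AbsRing (AbsRing_NormedModule C_AbsRing)
         (fun y => Cexp z * Cexp (y - z))%C).
{ intros y; rewrite <- Cexp_plus; f_equal; ring. }
apply (Cdifferentiable_mult (fun _ => Cexp z) (fun y => Cexp (y - z)%C));
  [apply Cdifferentiable_const|].
apply (Cdifferentiable_comp Cexp (fun y => y - z)%C).
- replace (z - z)%C with (RtoC 0) by ring; eexists; apply is_Cderive_exp_0.
- apply Cdifferentiable_minus; [apply Cdifferentiable_id|apply Cdifferentiable_const].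
Qed.

(** * Goursat's lemma *)

(** [Re] and [Im] are additive and bounded by the modulus, so continuity survives along an isometric
    path. The paths of interest are horizontal and vertical lines. *)
Lemma Ccontinuous_isometric_path (G : C -> C) (g : R -> C) (t : R) :
  (forall s, Cmod (g s - g t) = Rabs (s - t)) -> Ccontinuous G (g t) ->
  continuous (fun s => Re (G (g s))) t /\ continuous (fun s => Im (G (g s))) t.
Proof.
intros Hg HG.
assert (H : forall F : C -> R, (forall z, Rabs (F z) <= Cmod z) ->
  (forall a b, F (a - b)%C = F a - F b) -> continuous (fun s => F (G (g s))) t).
{ intros F HF1 HF2; apply filterlim_locally; intros e.
  destruct (proj1 (Ccontinuous_iff G (g t)) HG e (cond_pos e)) as (d & Hd & H).
  exists (mkposreal d Hd); intros s Hs.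
  change (Rabs (F (G (g s)) - F (G (g t))) < e); rewrite <- HF2.
  eapply Rle_lt_trans; [apply HF1|]; apply H; rewrite Hg; exact Hs. }
split; apply H; try (intros z; apply Rabs_le_Cmod); intros a b.
- unfold Cminus; rewrite re_plus, re_opp; reflexivity.
- unfold Cminus; rewrite im_plus, im_opp; reflexivity.
Qed.

Lemma Ccontinuous_horizontal (G : C -> C) (t y : R) :
  Ccontinuous G (t, y) -> continuous (fun s => Im (G (s, y))) t.
Proof.
intros H; apply (Ccontinuous_isometric_path G (fun s => (s, y))); [|exact H].
intros s; rewrite <- Cmod_R; f_equal; apply injective_projections; simpl; ring.
Qed.

Lemma Ccontinuous_vertical (G : C -> C) (x t : R) :
  Ccontinuous G (x, t) -> continuous (fun s => Re (G (x, s))) t.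
Proof.
intros H; apply (Ccontinuous_isometric_path G (fun s => (x, s))); [|exact H].
intros s; rewrite <- Cmod_R, <- (Rmult_1_l (Cmod (s - t)%R)), <- Cmod_Ci, <- Cmod_mult.
f_equal; apply injective_projections; simpl; ring.
Qed.

Lemma ex_RInt_on (f : R -> R) (a b : R) :
  a <= b -> (forall t, a <= t <= b -> continuous f t) -> ex_RInt f a b.
Proof.
intros Hab H; apply (@ex_RInt_continuous R_CompleteNormedModule).
rewrite Rmin_left, Rmax_right by exact Hab; exact H.
Qed.

(** Meant for two opposite sides of a square: [c] is the difference between the linear parts of the
    integrands, [m] a bound on the remainder. *)
Lemma RInt_difference_bound (f g : R -> R) (a h c m : R) :
  0 <= h -> ex_RInt f a (a + h) -> ex_RInt g a (a + h) ->
  (forall t, a <= t <= a + h -> Rabs (f t - g t - c) <= m) ->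
  Rabs (RInt f a (a + h) - RInt g a (a + h) - c * h) <= m * h.
Proof.
intros Hh Hf Hg H.
assert (E : RInt (fun t => minus (minus (f t) (g t)) c) a (a + h) =
            RInt f a (a + h) - RInt g a (a + h) - c * h).
{ rewrite (RInt_minus (V := R_CompleteNormedModule));
    [|apply (ex_RInt_minus (V := R_NormedModule)); assumption
     |apply (ex_RInt_const (V := R_NormedModule))].
  rewrite (RInt_minus (V := R_CompleteNormedModule)) by assumption.
  rewrite RInt_const; unfold minus, plus, opp, scal; simpl; unfold mult; simpl; ring. }
rewrite <- E, (Rmult_comm m h).
replace (h * m) with ((a + h - a) * m) by ring.
apply abs_RInt_le_const; [lra| |exact H].
apply (ex_RInt_minus (V := R_NormedModule));
  [apply (ex_RInt_minus (V := R_NormedModule)); assumption|].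
apply (ex_RInt_const (V := R_NormedModule)).
Qed.

(* The imaginary part of the integral of [G] along the boundary of the square. *)
Definition square_circulation (G : C -> C) (x y h : R) : R :=
  RInt (fun t => Im (G (t, y))) x (x + h) + RInt (fun t => Re (G (x + h, t))) y (y + h)
  - RInt (fun t => Im (G (t, y + h))) x (x + h) - RInt (fun t => Re (G (x, t))) y (y + h).

(** The inner sides are run through twice in opposite directions and cancel; the outer halves add
    up. *)
Lemma square_circulation_split (G : C -> C) (x y h : R) :
  0 < h ->
  (forall p q, x <= p <= x + 2 * h -> y <= q <= y + 2 * h -> Ccontinuous G (p, q)) ->
  square_circulation G x y (2 * h) =
    square_circulation G x y h + square_circulation G (x + h) y h +
    square_circulation G x (y + h) h + square_circulation G (x + h) (y + h) h.
Proof.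
intros Hh HG; unfold square_circulation.
replace (x + 2 * h) with (x + h + h) in * by ring.
replace (y + 2 * h) with (y + h + h) in * by ring.
assert (Hor : forall b, y <= b <= y + h + h ->
  RInt (fun t => Im (G (t, b))) x (x + h + h) =
  RInt (fun t => Im (G (t, b))) x (x + h) + RInt (fun t => Im (G (t, b))) (x + h) (x + h + h)).
{ intros b Hb; symmetry; apply (RInt_Chasles (V := R_CompleteNormedModule));
    apply ex_RInt_on; try lra; intros t Ht;
    apply Ccontinuous_horizontal, HG; lra. }
assert (Ver : forall b, x <= b <= x + h + h ->
  RInt (fun t => Re (G (b, t))) y (y + h + h) =
  RInt (fun t => Re (G (b, t))) y (y + h) + RInt (fun t => Re (G (b, t))) (y + h) (y + h + h)).
{ intros b Hb; symmetry; apply (RInt_Chasles (V := R_CompleteNormedModule));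
    apply ex_RInt_on; try lra; intros t Ht;
    apply Ccontinuous_vertical, HG; lra. }
rewrite (Hor y), (Hor (y + h + h)), (Ver x), (Ver (x + h + h)) by lra.
ring.
Qed.

(** For every e > 0 the circulation is at most e times the area: on small squares by
    differentiability, and the bound is inherited from the four quarters. *)
Theorem goursat_square (G : C -> C) (x0 y0 s0 : R) :
  0 < s0 ->
  (forall p q, x0 <= p <= x0 + s0 -> y0 <= q <= y0 + s0 -> Cdifferentiable G (p, q)) ->
  square_circulation G x0 y0 s0 = 0.
Proof.
intros Hs HG.
assert (HC : forall p q, x0 <= p <= x0 + s0 -> y0 <= q <= y0 + s0 -> Ccontinuous G (p, q))
  by (intros; apply Cdifferentiable_continuous, HG; assumption).
assert (Hbound : forall e, 0 < e -> Rabs (square_circulation G x0 y0 s0) <= e * s0 ^ 2).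
{ intros e He.
  (* Containment in the large square is part of the predicate, because [G] is controlled only
     there. *)
  apply (square_induction (fun x y h => x0 <= x -> x + h <= x0 + s0 -> y0 <= y ->
           y + h <= y0 + s0 -> Rabs (square_circulation G x y h) <= e * h ^ 2)
           x0 y0 s0 Hs); try lra.
  - intros x y h Hh H1 H2 H3 H4 Hx Hx' Hy Hy'.
    rewrite square_circulation_split by (auto; intros; apply HC; lra).
    specialize (H1 ltac:(lra) ltac:(lra) ltac:(lra) ltac:(lra)).
    specialize (H2 ltac:(lra) ltac:(lra) ltac:(lra) ltac:(lra)).
    specialize (H3 ltac:(lra) ltac:(lra) ltac:(lra) ltac:(lra)).
    specialize (H4 ltac:(lra) ltac:(lra) ltac:(lra) ltac:(lra)).
    replace (e * (2 * h) ^ 2) with (e * h ^ 2 + e * h ^ 2 + e * h ^ 2 + e * h ^ 2) by ring.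
    repeat (eapply Rle_trans; [apply Rabs_triang|apply Rplus_le_compat; auto]).
  - intros p q Hp Hq.
    destruct (HG p q Hp Hq) as [[al be] Hl].
    (* Points of the square lie within 2h of (p, q), so the remainder is at most e h / 4. Comparing
       opposite sides doubles it, and the two pairs of sides together give e h^2. *)
    destruct (proj1 (is_Cderive_iff _ _ _) Hl (e / 8)) as (d & Hd & HE); [lra|].
    exists (d / 2); split; [lra|].
    intros x y h Hh Hx Hy Hx0 Hx1 Hy0 Hy1.
    assert (Hexp : forall a b, x <= a <= x + h -> y <= b <= y + h ->
      Rabs (Re (G (a, b)) - Re (G (p, q)) - (al * (a - p) - be * (b - q))) <= e / 4 * h /\
      Rabs (Im (G (a, b)) - Im (G (p, q)) - (be * (a - p) + al * (b - q))) <= e / 4 * h).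
    { intros a b Ha Hb.
      assert (Hm : Cmod ((a, b) - (p, q)) <= 2 * h).
      { eapply Rle_trans; [apply Cmod_le_Rabs|]; simpl.
        assert (Rabs (a + - p) <= h) by (apply Rabs_le; lra).
        assert (Rabs (b + - q) <= h) by (apply Rabs_le; lra). lra. }
      specialize (HE (a, b) ltac:(lra)).
      assert (HE' : Cmod (G (a, b) - G (p, q) - ((a, b) - (p, q)) * (al, be)) <= e / 4 * h)
        by (eapply Rle_trans; [exact HE|]; nra).
      destruct (Rabs_le_Cmod (G (a, b) - G (p, q) - ((a, b) - (p, q)) * (al, be))) as [K1 K2].
      split; (eapply Rle_trans; [|exact HE']).
      - eapply Rle_trans; [|exact K1]; right; f_equal; unfold Re, Im; simpl; ring.
      - eapply Rle_trans; [|exact K2]; right; f_equal; unfold Re, Im; simpl; ring. }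
    (* The linear part contributes - al h^2 here and al h^2 in [B2]. That the same [al] occurs in
       both is a Cauchy-Riemann equation. *)
    assert (B1 : Rabs (RInt (fun t => Im (G (t, y))) x (x + h)
       - RInt (fun t => Im (G (t, y + h))) x (x + h) - (- al * h) * h) <= e / 2 * h * h).
    { apply RInt_difference_bound; [lra| | |].
      1, 2: apply ex_RInt_on; [lra|]; intros; apply Ccontinuous_horizontal, HC; lra.
      intros t Ht.
      destruct (Hexp t y) as [_ E1]; [lra..|]; destruct (Hexp t (y + h)) as [_ E2]; [lra..|].
      apply Rabs_le_between in E1, E2; apply Rabs_le; lra. }
    assert (B2 : Rabs (RInt (fun t => Re (G (x + h, t))) y (y + h)
       - RInt (fun t => Re (G (x, t))) y (y + h) - (al * h) * h) <= e / 2 * h * h).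
    { apply RInt_difference_bound; [lra| | |].
      1, 2: apply ex_RInt_on; [lra|]; intros; apply Ccontinuous_vertical, HC; lra.
      intros t Ht.
      destruct (Hexp x t) as [E1 _]; [lra..|]; destruct (Hexp (x + h) t) as [E2 _]; [lra..|].
      apply Rabs_le_between in E1, E2; apply Rabs_le; lra. }
    unfold square_circulation.
    apply Rabs_le_between in B1, B2; apply Rabs_le; simpl; lra. }
destruct (Req_dec (square_circulation G x0 y0 s0) 0) as [H|H]; [exact H|exfalso].
apply Rabs_pos_lt in H.
assert (Hs2 : 0 < s0 ^ 2) by (apply pow_lt; exact Hs).
(* This value of e turns the bound into k <= k / 2. *)
specialize (Hbound (Rabs (square_circulation G x0 y0 s0) / s0 ^ 2 / 2)).
set (k := Rabs (square_circulation G x0 y0 s0)) in *.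
replace (k / s0 ^ 2 / 2 * s0 ^ 2) with (k / 2) in Hbound by (field; lra).
assert (0 < k / s0 ^ 2 / 2) by (apply Rdiv_lt_0_compat; [apply Rdiv_lt_0_compat|]; lra).
specialize (Hbound H0); lra.
Qed.

(** * The mean value property *)

(** If Re F stayed below Re (F z1) - d on the circle, so would its average there. That average
    equals the one over arbitrarily small circles, which by continuity exceeds Re (F z1) - d. *)
Lemma circle_average_exceeds (F : C -> C) (z1 : C) (rho d : R) :
  0 < rho -> 0 < d -> Ccontinuous F z1 ->
  (forall z, 0 < Cmod (z - z1) <= rho -> Cdifferentiable F z) ->
  exists z, Cmod (z - z1) = rho /\ Re (F z1) - d <= Re (F z).
Proof.
intros Hrho Hd Hcont Hdiff.
apply NNPP; intros Hno.
(* The half-plane Re z <= 0 covers the punctured closed disc; a vertical segment of length 2 pi at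
   abscissa x covers the circle of radius rho e^x. *)
set (pol := fun z : C => (z1 + RtoC rho * Cexp z)%C).
set (G := fun z : C => F (pol z)).
assert (Hpol : forall z, Cmod (pol z - z1) = rho * exp (Re z)).
{ intros z; unfold pol; replace (z1 + rho * Cexp z - z1)%C with (rho * Cexp z)%C by ring.
  rewrite Cmod_mult, Cmod_R, Cmod_Cexp, Rabs_pos_eq; lra. }
assert (HG : forall x y, x <= 0 -> Cdifferentiable G (x, y)).
{ intros x y Hx; apply (Cdifferentiable_comp F pol).
  - apply Hdiff; rewrite Hpol; simpl Re.
    assert (0 < exp x) by apply exp_pos.
    assert (exp x <= 1).
    { rewrite <- exp_0; destruct Hx as [Hx| ->]; [left; apply exp_increasing; exact Hx|lra]. }
    split; [apply Rmult_lt_0_compat; lra|nra].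
  - apply Cdifferentiable_plus; [apply Cdifferentiable_const|].
    apply Cdifferentiable_mult; [apply Cdifferentiable_const|apply Cdifferentiable_exp]. }
assert (HPI : 3 < PI) by (generalize PI2_3_2; lra).
(* [U x] is 2 pi times the average of Re F over that circle. The limit [0 + 2 * PI] matches the form
   of [square_circulation]. *)
set (U := fun x => RInt (fun t => Re (G (x, t))) 0 (0 + 2 * PI)).
assert (Hint : forall x, x <= 0 -> ex_RInt (fun t => Re (G (x, t))) 0 (0 + 2 * PI)).
{ intros x Hx; apply ex_RInt_on; [lra|]; intros t _.
  apply Ccontinuous_vertical, Cdifferentiable_continuous, HG, Hx. }
(* The horizontal sides of the square cancel because [exp] has period 2 i pi. *)
assert (Hstep : forall x, x + 2 * PI <= 0 -> U (x + 2 * PI) = U x).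
{ intros x Hx.
  assert (H := goursat_square G x 0 (2 * PI) ltac:(lra)
    ltac:(intros; apply HG; lra)).
  unfold square_circulation in H.
  rewrite (RInt_ext (V := R_CompleteNormedModule) (fun t => Im (G (t, 0 + 2 * PI)))
     (fun t => Im (G (t, 0)))) in H.
  - unfold U; lra.
  - intros t _; unfold G, pol, Cexp; simpl Re; simpl Im.
    rewrite Rplus_0_l, cos_2PI, sin_2PI, cos_0, sin_0; reflexivity. }
assert (Hconst : forall n, U (- (INR n * (2 * PI))) = U 0).
{ induction n as [|n IH].
  - f_equal; simpl; ring.
  - rewrite <- IH; replace (- (INR n * (2 * PI))) with (- (INR (S n) * (2 * PI)) + 2 * PI)
      by (rewrite S_INR; ring).
    symmetry; apply Hstep.
    generalize (pos_INR n); rewrite S_INR; nra. }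
assert (Hout : U 0 <= 2 * PI * (Re (F z1) - d)).
{ unfold U; replace (2 * PI * (Re (F z1) - d))
    with (RInt (fun _ => Re (F z1) - d) 0 (0 + 2 * PI))
    by (rewrite RInt_const; unfold scal; simpl; unfold mult; simpl; ring).
  apply RInt_le; [lra|apply Hint; lra|apply (ex_RInt_const (V := R_NormedModule))|].
  intros t _; apply Rnot_lt_le; intros Hlt; apply Hno.
  exists (pol (0, t)); split; [rewrite Hpol; simpl; rewrite exp_0; ring|].
  left; exact Hlt. }
destruct (proj1 (Ccontinuous_iff F z1) Hcont (d / 2)) as (e & He & Hnear); [lra|].
(* Since exp (2 pi n) > n > rho / e, the n-th circle has radius less than e. *)
destruct (INR_unbounded (rho / e)) as [n Hn].
assert (Hin : 2 * PI * (Re (F z1) - d / 2) <= U (- (INR n * (2 * PI)))).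
{ unfold U; replace (2 * PI * (Re (F z1) - d / 2))
    with (RInt (fun _ => Re (F z1) - d / 2) 0 (0 + 2 * PI))
    by (rewrite RInt_const; unfold scal; simpl; unfold mult; simpl; ring).
  assert (0 <= INR n) by apply pos_INR.
  apply RInt_le; [lra|apply (ex_RInt_const (V := R_NormedModule))|apply Hint; nra|].
  intros t _.
  assert (Hc : Cmod (pol (- (INR n * (2 * PI)), t) - z1) < e).
  { rewrite Hpol; simpl Re; rewrite exp_Ropp.
    apply Rmult_lt_reg_r with (exp (INR n * (2 * PI))); [apply exp_pos|].
    rewrite Rmult_assoc, Rinv_l, Rmult_1_r
      by (apply Rgt_not_eq, exp_pos).
    assert (INR n < exp (INR n * (2 * PI))).
    { generalize (exp_ineq1_le (INR n * (2 * PI))); nra. }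
    replace rho with (e * (rho / e)) by (field; lra).
    apply Rmult_lt_compat_l; lra. }
  specialize (Hnear _ Hc).
  destruct (Rabs_le_Cmod (F (pol (- (INR n * (2 * PI)), t)) - F z1)) as [K _].
  unfold Cminus in K at 1; rewrite re_plus, re_opp in K.
  assert (K' : Rabs (Re (F (pol (- (INR n * (2 * PI)), t))) + - Re (F z1)) < d / 2) by lra.
  apply Rabs_def2 in K'; unfold G; lra. }
rewrite Hconst in Hin; nra.
Qed.

(** * The maximum modulus principle *)

(* [T] is meant to be an interval unbounded below, either the whole line or [M < S]. *)
Lemma compact_upper_bound (K : C -> Prop) (g : C -> R) (T : R -> Prop) (B : R) :
  0 < B ->
  (forall z, K z -> Cmod z <= B) ->
  (forall z, ~ K z -> exists d, 0 < d /\ forall y, Cmod (y - z) < d -> ~ K y) ->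
  (exists M, T M) ->
  (forall z, K z -> exists M, T M /\
     exists d, 0 < d /\ forall y, Cmod (y - z) < d -> g y <= M) ->
  exists M, T M /\ forall z, K z -> g z <= M.
Proof.
intros HB Hbd Hcl [M0 HM0] Hloc.
assert (Hmax : forall M1 M2, T M1 -> T M2 -> T (Rmax M1 M2))
  by (intros M1 M2; unfold Rmax; destruct (Rle_dec M1 M2); auto).
destruct (square_induction (fun x y h => exists M, T M /\ forall a b,
  x <= a <= x + h -> y <= b <= y + h -> K (a, b) -> g (a, b) <= M)
  (- B) (- B) (2 * B)) as (M & HM & H).
- lra.
- intros x y h Hh (M1 & T1 & H1) (M2 & T2 & H2) (M3 & T3 & H3) (M4 & T4 & H4).
  exists (Rmax (Rmax M1 M2) (Rmax M3 M4)); split; [auto|].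
  intros a b Ha Hb HK.
  generalize (Rmax_l M1 M2) (Rmax_r M1 M2) (Rmax_l M3 M4) (Rmax_r M3 M4)
    (Rmax_l (Rmax M1 M2) (Rmax M3 M4)) (Rmax_r (Rmax M1 M2) (Rmax M3 M4)); intros.
  destruct (Rle_dec a (x + h)); destruct (Rle_dec b (y + h)).
  + specialize (H1 a b ltac:(lra) ltac:(lra) HK); lra.
  + specialize (H3 a b ltac:(lra) ltac:(lra) HK); lra.
  + specialize (H2 a b ltac:(lra) ltac:(lra) HK); lra.
  + specialize (H4 a b ltac:(lra) ltac:(lra) HK); lra.
- intros p q _ _.
  assert (H : exists M, T M /\ exists d, 0 < d /\
    forall y, Cmod (y - (p, q)) < d -> K y -> g y <= M).
  { destruct (classic (K (p, q))) as [HK|HK].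
    - destruct (Hloc _ HK) as (M & HM & d & Hd & H).
      exists M; split; [exact HM|]; exists d; split; auto.
    - destruct (Hcl _ HK) as (d & Hd & H).
      exists M0; split; [exact HM0|]; exists d; split; [exact Hd|].
      intros y Hy HKy; elim (H y Hy HKy). }
  destruct H as (M & HM & d & Hd & H).
  exists (d / 2); split; [lra|]; intros x y h Hh Hx Hy.
  exists M; split; [exact HM|]; intros a b Ha Hb HK; apply H; [|exact HK].
  eapply Rle_lt_trans; [apply Cmod_le_Rabs|]; simpl.
  assert (Rabs (a + - p) <= h) by (apply Rabs_le; lra).
  assert (Rabs (b + - q) <= h) by (apply Rabs_le; lra). lra.
- exists M; split; [exact HM|]; intros z HK.
  destruct (Rabs_le_Cmod z) as [K1 K2]; specialize (Hbd z HK).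
  assert (Rabs (Re z) <= B) by lra; assert (Rabs (Im z) <= B) by lra.
  apply Rabs_le_between in H0, H1.
  rewrite (surjective_pairing z) in HK |- *; apply H; auto; unfold Re, Im in *; lra.
Qed.

(** Upper semicontinuity bounds [g] locally. If the supremum S were not attained, compactness
    applied to bounds strictly below S would give a uniform bound less than S. *)
Lemma compact_attains_max (K : C -> Prop) (g : C -> R) (B : R) (z0 : C) :
  0 < B ->
  (forall z, K z -> Cmod z <= B) ->
  (forall z, ~ K z -> exists d, 0 < d /\ forall y, Cmod (y - z) < d -> ~ K y) ->
  K z0 ->
  (forall z, K z -> forall e, 0 < e ->
     exists d, 0 < d /\ forall y, Cmod (y - z) < d -> g y < g z + e) ->
  exists z1, K z1 /\ forall z, K z -> g z <= g z1.
Proof.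
intros HB Hbd Hcl H0 Hg.
destruct (compact_upper_bound K g (fun _ => True) B HB Hbd Hcl) as (M & _ & HM).
{ exists 0; exact I. }
{ intros z HK; exists (g z + 1); split; [exact I|].
  destruct (Hg z HK 1 Rlt_0_1) as (d & Hd & H); exists d; split; [exact Hd|].
  intros y Hy; left; auto. }
destruct (completeness (fun r => exists z, K z /\ r = g z)) as [S [HS1 HS2]].
{ exists M; intros r (z & Hz & ->); auto. }
{ exists (g z0), z0; auto. }
apply NNPP; intros Hno.
assert (Hlt : forall z, K z -> g z < S).
{ intros z HK; destruct (Rle_lt_or_eq_dec (g z) S) as [L|E]; [apply HS1; eauto|exact L|].
  exfalso; apply Hno; exists z; split; [exact HK|].
  intros y Hy; rewrite E; apply HS1; eauto. }
destruct (compact_upper_bound K g (fun m => m < S) B HB Hbd Hcl) as (m & Hm & Hm').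
{ exists (g z0); auto. }
{ intros z HK; specialize (Hlt z HK); exists ((g z + S) / 2); split; [lra|].
  destruct (Hg z HK ((S - g z) / 2)) as (d & Hd & H); [lra|].
  exists d; split; [exact Hd|]; intros y Hy; specialize (H y Hy); lra. }
assert (S <= m) by (apply HS2; intros r (z & Hz & ->); auto). lra.
Qed.

Lemma Ccontinuous_Cmod_sqr_lt (f : C -> C) (z : C) (e : R) :
  Ccontinuous f z -> 0 < e ->
  exists d, 0 < d /\ forall y, Cmod (y - z) < d -> Cmod (f y) ^ 2 < Cmod (f z) ^ 2 + e.
Proof.
intros Hf He; set (m := Cmod (f z)); assert (Hm : 0 <= m) by apply Cmod_ge_0.
(* If k = |f y - f z| < 1 and k (2m + 2) < e, then (m + k)^2 < m^2 + e. *)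
assert (He' : 0 < Rmin 1 (e / (2 * m + 2))).
{ apply Rmin_pos; [lra|apply Rdiv_lt_0_compat; lra]. }
destruct (proj1 (Ccontinuous_iff f z) Hf _ He') as (d & Hd & H).
exists d; split; [exact Hd|]; intros y Hy; specialize (H y Hy).
apply Rmin_Rgt_l in H; destruct H as [H1 H2].
generalize (Cmod_triangle (f z) (f y - f z)).
replace (f z + (f y - f z))%C with (f y) by ring; fold m; intros H3.
set (k := Cmod (f y - f z)) in *.
assert (Hk : k * (2 * m + 2) < e).
{ replace e with (e / (2 * m + 2) * (2 * m + 2)) by (field; lra).
  apply Rmult_lt_compat_r; lra. }
assert (0 <= k) by apply Cmod_ge_0; assert (0 <= Cmod (f y)) by apply Cmod_ge_0.
nra.
Qed.

(* The exceptional point [w], where only continuity is asked, lets the principle apply to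
   difference quotients, whose differentiability at [w] is not known beforehand. *)
Theorem maximum_modulus (K : C -> Prop) (F : C -> C) (w : C) (B M : R) :
  0 < B ->
  (forall z, K z -> Cmod z <= B) ->
  (forall z, ~ K z -> exists d, 0 < d /\ forall y, Cmod (y - z) < d -> ~ K y) ->
  (forall z, K z -> Ccontinuous F z) ->
  (forall z, K z -> z <> w -> Cdifferentiable F z) ->
  0 <= M ->
  (forall z, K z -> Cmod (F z) <= M \/
     exists d, 0 < d /\ forall y, Cmod (y - z) < d -> K y) ->
  forall z, K z -> Cmod (F z) <= M.
Proof.
intros HB Hbd Hcl Hcont Hdiff HM Hbdry z0 Hz0.
apply Rnot_lt_le; intros Hlt.
(* The extra term e |z|^2 makes the comparison on circles strict. As e B^2 is half the gap between
   |F z0|^2 and M^2, a maximum point of |F|^2 + e |z|^2 still has |F| > M. *)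
set (e := (Cmod (F z0) ^ 2 - M ^ 2) / (2 * B ^ 2)).
assert (HB2 : 0 < B ^ 2) by (apply pow_lt; exact HB).
assert (Hgap : M ^ 2 < Cmod (F z0) ^ 2) by nra.
assert (He : 0 < e) by (apply Rdiv_lt_0_compat; lra).
assert (HeB : M ^ 2 + e * B ^ 2 < Cmod (F z0) ^ 2).
{ replace (e * B ^ 2) with ((Cmod (F z0) ^ 2 - M ^ 2) / 2) by (unfold e; field; lra). lra. }
destruct (compact_attains_max K (fun z => Cmod (F z) ^ 2 + e * Cmod z ^ 2) B z0)
  as (z1 & Hz1 & Hmax); auto.
{ intros z HK e' He'.
  destruct (Ccontinuous_Cmod_sqr_lt F z (e' / 2)) as (d1 & Hd1 & H1); [auto|lra|].
  destruct (Ccontinuous_Cmod_sqr_lt (fun y => y) z (e' / (2 * e))) as (d2 & Hd2 & H2).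
  { apply Cdifferentiable_continuous, Cdifferentiable_id. }
  { apply Rdiv_lt_0_compat; lra. }
  exists (Rmin d1 d2); split; [apply Rmin_pos; auto|].
  intros y Hy; apply Rmin_Rgt_l in Hy; destruct Hy as [Hy1 Hy2].
  specialize (H1 y Hy1); specialize (H2 y Hy2).
  apply (Rmult_lt_compat_l e) in H2; [|exact He].
  replace (e * (Cmod z ^ 2 + e' / (2 * e))) with (e * Cmod z ^ 2 + e' / 2) in H2
    by (field; lra). lra. }
assert (Hbig : M < Cmod (F z1)).
{ specialize (Hmax z0 Hz0); simpl in Hmax; specialize (Hbd z1 Hz1).
  assert (Cmod z1 ^ 2 <= B ^ 2) by (apply pow_incr; split; [apply Cmod_ge_0|exact Hbd]).
  assert (0 <= Cmod z0 ^ 2) by apply pow2_ge_0.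
  apply Rnot_le_lt; intros Hle.
  assert (Cmod (F z1) ^ 2 <= M ^ 2) by (apply pow_incr; split; [apply Cmod_ge_0|exact Hle]).
  nra. }
destruct (Hbdry z1 Hz1) as [Hle|(d & Hd & Hball)]; [lra|].
(* The punctured disc of radius rho must avoid [w]: the puncture does so when z1 = w, a small radius
   otherwise. *)
assert (Hrho : exists rho, 0 < rho /\ rho < d /\
  forall z, 0 < Cmod (z - z1) <= rho -> z <> w).
{ destruct (Ceq_dec z1 w) as [->|Hne].
  - exists (d / 2); repeat split; try lra.
    intros z [Hz _] ->; replace (w - w)%C with (RtoC 0) in Hz by ring.
    rewrite Cmod_0 in Hz; lra.
  - assert (Hp : 0 < Cmod (w - z1)).
    { apply Cmod_gt_0; intros E; apply Hne; apply Ceq_minus in E; auto. }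
    exists (Rmin d (Cmod (w - z1)) / 2).
    generalize (Rmin_l d (Cmod (w - z1))) (Rmin_r d (Cmod (w - z1))) (Rmin_pos _ _ Hd Hp).
    intros; repeat split; try lra.
    intros z [_ Hz] ->; lra. }
destruct Hrho as (rho & Hrho & Hrd & Hrw).
(* Polarization of |F|^2 + e |z|^2 at z1: the real part of this expression equals that function up
   to a constant and squares of distances. *)
set (Phi := fun z => (RtoC 2 * Cconj (F z1) * F z + RtoC (2 * e) * Cconj z1 * z)%C).
(* On the circle, maximality at z1 makes Re Phi drop by at least e rho^2, twice the drop allowed
   here. *)
destruct (circle_average_exceeds Phi z1 rho (e * rho ^ 2 / 2)) as (z & Hz & Hge); auto.
{ assert (0 < rho ^ 2) by (apply pow_lt; exact Hrho).
  apply Rdiv_lt_0_compat; [apply Rmult_lt_0_compat|]; lra. }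
{ apply (Ccontinuous_plus (fun z => RtoC 2 * Cconj (F z1) * F z)%C
    (fun z => RtoC (2 * e) * Cconj z1 * z)%C);
    [apply (Ccontinuous_mult (fun _ => RtoC 2 * Cconj (F z1))%C F)
    |apply (Ccontinuous_mult (fun _ => RtoC (2 * e) * Cconj z1)%C (fun z => z))].
  - apply Cdifferentiable_continuous, Cdifferentiable_const.
  - apply Hcont, Hz1.
  - apply Cdifferentiable_continuous, Cdifferentiable_const.
  - apply Cdifferentiable_continuous, Cdifferentiable_id. }
{ intros z Hz; apply (Cdifferentiable_plus (fun z => RtoC 2 * Cconj (F z1) * F z)%C
    (fun z => RtoC (2 * e) * Cconj z1 * z)%C);
    [apply (Cdifferentiable_mult (fun _ => RtoC 2 * Cconj (F z1))%C F)
    |apply (Cdifferentiable_mult (fun _ => RtoC (2 * e) * Cconj z1)%C (fun z => z))].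
  - apply Cdifferentiable_const.
  - apply Hdiff; [apply Hball; lra|apply Hrw, Hz].
  - apply Cdifferentiable_const.
  - apply Cdifferentiable_id. }
assert (Hrho2 : 0 < rho ^ 2) by (apply pow_lt; exact Hrho).
specialize (Hmax z (Hball z ltac:(lra))); simpl in Hmax.
rewrite <- Hz in Hge, Hrho2.
(* |a|^2 = 2 Re (conj b * a) - |b|^2 + |a - b|^2 *)
assert (Q : Re (Phi z) - Re (Phi z1) = Cmod (F z) ^ 2 + e * Cmod z ^ 2
  - (Cmod (F z1) ^ 2 + e * Cmod z1 ^ 2) - Cmod (F z - F z1) ^ 2 - e * Cmod (z - z1) ^ 2).
{ rewrite !Cmod2_alt; unfold Phi; destruct (F z), (F z1), z, z1; simpl; ring. }
assert (0 <= Cmod (F z - F z1) ^ 2) by apply pow2_ge_0.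
assert (0 < e * Cmod (z - z1) ^ 2) by (apply Rmult_lt_0_compat; lra).
simpl in *; lra.
Qed.

(** * The Schwarz-Pick lemma *)

(** With [l] the derivative of [f] at [w], this is the continuous extension of the quotient to
    [w]. *)
Definition difference_quotient (f : C -> C) (w l y : C) : C :=
  if Ceq_dec y w then l else ((f y - f w) / (y - w))%C.

Lemma Cminus_neq_0 (a b : C) : a <> b -> (a - b)%C <> RtoC 0.
Proof. intros H E; apply H, Ceq_minus, E. Qed.

Lemma Ccontinuous_difference_quotient (f : C -> C) (w l : C) :
  @is_derive C_AbsRing (AbsRing_NormedModule C_AbsRing) f w l ->
  Ccontinuous (difference_quotient f w l) w.
Proof.
intros Hl; apply Ccontinuous_iff; intros e He.
destruct (proj1 (is_Cderive_iff f w l) Hl (e / 2)) as (d & Hd & H); [lra|].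
exists d; split; [exact Hd|]; intros y Hy; specialize (H y Hy).
unfold difference_quotient at 2; destruct (Ceq_dec w w) as [_|n]; [|elim n; reflexivity].
unfold difference_quotient; destruct (Ceq_dec y w) as [_|n].
- replace (l - l)%C with (RtoC 0) by ring; rewrite Cmod_0; exact He.
- assert (Hn := Cminus_neq_0 _ _ n).
  replace ((f y - f w) / (y - w) - l)%C with ((f y - f w - (y - w) * l) / (y - w))%C
    by (field; exact Hn).
  rewrite Cmod_div by exact Hn; apply Cmod_gt_0 in Hn.
  apply Rle_lt_trans with (e / 2); [|lra].
  apply Rmult_le_reg_r with (Cmod (y - w)); [exact Hn|].
  unfold Rdiv at 1; rewrite Rmult_assoc, Rinv_l, Rmult_1_r; lra.
Qed.

Lemma Cdifferentiable_difference_quotient (f : C -> C) (w l z : C) :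
  z <> w -> Cdifferentiable f z -> Cdifferentiable (difference_quotient f w l) z.
Proof.
intros Hzw Hf.
apply (@ex_derive_ext_loc C_AbsRing (AbsRing_NormedModule C_AbsRing)
         (fun y => (f y - f w) * / (y - w))%C).
- apply Clocally_iff; exists (Cmod (z - w)); split.
  + apply Cmod_gt_0, Cminus_neq_0, Hzw.
  + intros y Hy; unfold difference_quotient; destruct (Ceq_dec y w) as [->|_]; [|reflexivity].
    rewrite Cmod_minus_sym in Hy; lra.
- apply (Cdifferentiable_mult (fun y => f y - f w)%C (fun y => / (y - w))%C).
  + apply (Cdifferentiable_minus f (fun _ => f w)); [exact Hf|apply Cdifferentiable_const].
  + apply (Cdifferentiable_comp Cinv (fun y => y - w)%C).
    * apply Cdifferentiable_inv, Cminus_neq_0, Hzw.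
    * apply (Cdifferentiable_minus (fun y => y) (fun _ => w));
        [apply Cdifferentiable_id|apply Cdifferentiable_const].
Qed.

Lemma Cmod_minus_conj_sqr (y w : C) :
  Cmod (y - Cconj w) ^ 2 = Cmod (y - w) ^ 2 + 4 * Im y * Im w.
Proof. rewrite !Cmod2_alt; destruct y, w; simpl; ring. Qed.

Lemma Cmod_minus_lt_conj (y w : C) :
  0 < Im y -> 0 < Im w -> Cmod (y - w) < Cmod (y - Cconj w).
Proof.
intros Hy Hw; generalize (Cmod_minus_conj_sqr y w) (Cmod_ge_0 (y - w)) (Cmod_ge_0 (y - Cconj w)).
intros; assert (0 < 4 * Im y * Im w) by (repeat apply Rmult_lt_0_compat; lra).
apply Rnot_le_lt; intros Hle.
assert (Cmod (y - Cconj w) ^ 2 <= Cmod (y - w) ^ 2) by (apply pow_incr; auto).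
lra.
Qed.

Lemma Cmod_minus_lipschitz (a y z : C) :
  Cmod (y - a) <= Cmod (z - a) + Cmod (y - z).
Proof.
replace (y - a)%C with ((z - a) + (y - z))%C by ring; apply Cmod_triangle.
Qed.

(** For Im w > 0 and 0 < r < 1 this is an Apollonius disc, the closed ball of radius r about w in
    the pseudo-hyperbolic metric. The product form avoids dividing by zero at the conjugate of w. *)
Definition pseudo_hyperbolic_disc (w : C) (r : R) (y : C) : Prop :=
  Cmod (y - w) <= r * Cmod (y - Cconj w).

(** The distance from w to its conjugate is 2 Im w, so D = |y - conj w| satisfies D <= r D + 2 Im
    w. *)
Lemma disc_bounded (w : C) (r : R) (y : C) :
  0 < Im w -> 0 < r < 1 -> pseudo_hyperbolic_disc w r y -> Cmod y <= 2 * Im w / (1 - r) + Cmod w.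
Proof.
unfold pseudo_hyperbolic_disc; intros Hw Hr H.
assert (H1 : Cmod (y - Cconj w) <= Cmod (y - w) + 2 * Im w).
{ replace (y - Cconj w)%C with ((y - w) + (w - Cconj w))%C by ring.
  eapply Rle_trans; [apply Cmod_triangle|]; apply Rplus_le_compat_l.
  rewrite im_alt', !Cmod_mult, Cmod_Ci, !Cmod_R, !Rabs_pos_eq; lra. }
assert (H2 : Cmod (y - Cconj w) <= 2 * Im w / (1 - r)).
{ apply Rmult_le_reg_r with (1 - r); [lra|].
  unfold Rdiv; rewrite (Rmult_assoc (2 * Im w)), Rinv_l; lra. }
replace y with ((y - Cconj w) + Cconj w)%C at 1 by ring.
eapply Rle_trans; [apply Cmod_triangle|]; rewrite Cmod_conj; lra.
Qed.

(** The function |y - w| - r |y - conj w| is Lipschitz with constant 1 + r < 2, so its sign persists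
    up to half its absolute value. The same reason yields [disc_interior]. *)
Lemma disc_closed (w : C) (r : R) (z : C) :
  0 < r < 1 -> ~ pseudo_hyperbolic_disc w r z ->
  exists d, 0 < d /\ forall y, Cmod (y - z) < d -> ~ pseudo_hyperbolic_disc w r y.
Proof.
unfold pseudo_hyperbolic_disc; intros Hr H; apply Rnot_le_lt in H.
exists ((Cmod (z - w) - r * Cmod (z - Cconj w)) / 2); split; [lra|].
intros y Hy; apply Rlt_not_le.
generalize (Cmod_minus_lipschitz w z y) (Cmod_minus_lipschitz (Cconj w) y z).
rewrite (Cmod_minus_sym z y); generalize (Cmod_ge_0 (y - z)); nra.
Qed.

Lemma disc_interior (w : C) (r : R) (z : C) :
  0 < r < 1 -> Cmod (z - w) < r * Cmod (z - Cconj w) ->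
  exists d, 0 < d /\ forall y, Cmod (y - z) < d -> pseudo_hyperbolic_disc w r y.
Proof.
unfold pseudo_hyperbolic_disc; intros Hr H.
exists ((r * Cmod (z - Cconj w) - Cmod (z - w)) / 2); split; [lra|].
intros y Hy.
generalize (Cmod_minus_lipschitz w y z) (Cmod_minus_lipschitz (Cconj w) z y).
rewrite (Cmod_minus_sym z y); generalize (Cmod_ge_0 (y - z)); nra.
Qed.

(** Equality y = conj w would force y = w as well, against Im w > 0. Hence |y - w| < |y - conj w|,
    and the difference of the squares is 4 Im y Im w. *)
Lemma disc_subset_upper (w : C) (r : R) (y : C) :
  0 < Im w -> 0 < r < 1 -> pseudo_hyperbolic_disc w r y ->
  0 < Cmod (y - Cconj w) /\ 0 < Im y.
Proof.
unfold pseudo_hyperbolic_disc; intros Hw Hr H.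
assert (Hpos : 0 < Cmod (y - Cconj w)).
{ apply Rnot_le_lt; intros Hle.
  generalize (Cmod_ge_0 (y - Cconj w)) (Cmod_ge_0 (y - w)); intros.
  assert (E1 : Cmod (y - w) = 0) by nra.
  assert (E2 : Cmod (y - Cconj w) = 0) by lra.
  apply Cmod_eq_0, Ceq_minus in E1, E2; rewrite E1 in E2.
  assert (Im w = - Im w) by (rewrite <- im_conj, <- E2; reflexivity). lra. }
split; [exact Hpos|].
generalize (Cmod_minus_conj_sqr y w) (Cmod_ge_0 (y - w)); intros.
assert (Cmod (y - w) < Cmod (y - Cconj w)) by nra.
assert (0 < Im y * Im w) by nra. nra.
Qed.

Theorem schwarz_pick_upper_half_plane (f : C -> C) (z w : C) :
  (forall y, 0 < Im y -> Cdifferentiable f y) ->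
  (forall y, 0 < Im y -> 0 < Im (f y)) ->
  0 < Im z -> 0 < Im w ->
  Cmod (f z - f w) * Cmod (z - Cconj w) <= Cmod (f z - Cconj (f w)) * Cmod (z - w).
Proof.
intros Hf Him Hz Hw.
destruct (Ceq_dec z w) as [->|Hzw].
{ replace (f w - f w)%C with (RtoC 0) by ring; replace (w - w)%C with (RtoC 0) by ring.
  rewrite Cmod_0; lra. }
destruct (Hf w Hw) as [l Hl].
(* Only the first factor is delicate at [w]; the second is differentiable on the whole
   half-plane. *)
set (F := fun y => (difference_quotient f w l y * ((y - Cconj w) * / (f y - Cconj (f w))))%C).
assert (Hden : forall y, 0 < Im y -> (f y - Cconj (f w))%C <> RtoC 0).
{ intros y Hy; apply Cmod_gt_0.
  eapply Rle_lt_trans; [apply Cmod_ge_0|apply Cmod_minus_lt_conj; auto]. }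
assert (Hfac : forall y, 0 < Im y ->
  Cdifferentiable (fun y => (y - Cconj w) * / (f y - Cconj (f w)))%C y).
{ intros y Hy.
  apply (Cdifferentiable_mult (fun y => y - Cconj w)%C (fun y => / (f y - Cconj (f w)))%C).
  - apply (Cdifferentiable_minus (fun y => y) (fun _ => Cconj w));
      [apply Cdifferentiable_id|apply Cdifferentiable_const].
  - apply (Cdifferentiable_comp Cinv (fun y => f y - Cconj (f w))%C).
    + apply Cdifferentiable_inv, Hden, Hy.
    + apply (Cdifferentiable_minus f (fun _ => Cconj (f w)));
        [apply Hf, Hy|apply Cdifferentiable_const]. }
assert (HdF : forall y, 0 < Im y -> y <> w -> Cdifferentiable F y).
{ intros y Hy Hne; apply (Cdifferentiable_mult (difference_quotient f w l)
    (fun y => (y - Cconj w) * / (f y - Cconj (f w)))%C); [|auto].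
  apply Cdifferentiable_difference_quotient; auto. }
assert (HcF : forall y, 0 < Im y -> Ccontinuous F y).
{ intros y Hy; destruct (Ceq_dec y w) as [->|n].
  - apply (Ccontinuous_mult (difference_quotient f w l)
      (fun y => (y - Cconj w) * / (f y - Cconj (f w)))%C).
    + apply Ccontinuous_difference_quotient, Hl.
    + apply Cdifferentiable_continuous, Hfac, Hw.
  - apply Cdifferentiable_continuous, HdF; auto. }
assert (HmF : forall y, 0 < Im y -> y <> w ->
  Cmod (F y) * (Cmod (f y - Cconj (f w)) * Cmod (y - w)) =
  Cmod (f y - f w) * Cmod (y - Cconj w)).
{ intros y Hy n; rewrite <- !Cmod_mult; f_equal; unfold F, difference_quotient.
  destruct (Ceq_dec y w) as [E|_]; [elim (n E)|].
  field; split; [apply Hden, Hy|apply Cminus_neq_0, n]. }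
assert (Hr0 : 0 < Cmod (z - w)) by (apply Cmod_gt_0, Cminus_neq_0, Hzw).
assert (Hr1 := Cmod_minus_lt_conj z w Hz Hw).
(* The least radius whose disc contains [z]. *)
set (r0 := Cmod (z - w) / Cmod (z - Cconj w)).
assert (Hr0' : 0 < r0 < 1).
{ unfold r0; split; [apply Rdiv_lt_0_compat; lra|].
  apply Rmult_lt_reg_r with (Cmod (z - Cconj w)); [lra|].
  unfold Rdiv; rewrite Rmult_assoc, Rinv_l; lra. }
assert (Hall : forall r, r0 <= r < 1 -> Cmod (F z) <= / r).
{ intros r Hr; assert (Hr' : 0 < r < 1) by lra.
  apply (maximum_modulus (pseudo_hyperbolic_disc w r) F w
    (2 * Im w / (1 - r) + Cmod w) (/ r)).
  - assert (0 < 2 * Im w / (1 - r)) by (apply Rdiv_lt_0_compat; lra).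
    generalize (Cmod_ge_0 w); lra.
  - intros y; apply disc_bounded; auto.
  - intros y; apply disc_closed; auto.
  - intros y Hy; apply HcF; apply (disc_subset_upper w r); auto.
  - intros y Hy; apply HdF; apply (disc_subset_upper w r); auto.
  - left; apply Rinv_0_lt_compat; lra.
  - intros y Hy; destruct (disc_subset_upper w r y Hw Hr' Hy) as [Hp Hi].
    (* On the rim |y - w| = r |y - conj w|, and |f y - f w| < |f y - conj (f w)| gives |F y| <= 1 /
       r. *)
    destruct (Rle_lt_or_eq_dec _ _ Hy) as [L|E]; [right; apply disc_interior; auto|left].
    assert (Hpos : 0 < Cmod (y - w)) by (rewrite E; apply Rmult_lt_0_compat; lra).
    assert (n : y <> w).
    { intros ->; replace (w - w)%C with (RtoC 0) in Hpos by ring; rewrite Cmod_0 in Hpos; lra. }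
    assert (Hm := HmF y Hi n); rewrite E in Hm.
    assert (H1 := Cmod_minus_lt_conj (f y) (f w) (Him y Hi) (Him w Hw)).
    generalize (Cmod_ge_0 (f y - f w)); intros H0.
    assert (E2 : Cmod (F y) * Cmod (f y - Cconj (f w)) * r = Cmod (f y - f w)).
    { apply Rmult_eq_reg_r with (Cmod (y - Cconj w)); lra. }
    apply Rmult_le_reg_r with (Cmod (f y - Cconj (f w)) * r);
      [apply Rmult_lt_0_compat; lra|].
    replace (/ r * (Cmod (f y - Cconj (f w)) * r)) with (Cmod (f y - Cconj (f w)))
      by (field; lra). lra.
  - apply Rmult_le_reg_r with (/ Cmod (z - Cconj w)); [apply Rinv_0_lt_compat; lra|].
    rewrite Rmult_assoc, Rinv_r by lra; fold (Cmod (z - w) / Cmod (z - Cconj w)).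
    fold r0; lra. }
assert (HF : Cmod (F z) <= 1).
{ apply Rnot_lt_le; intros Hgt.
  assert (Hinv : 0 < / Cmod (F z) < 1).
  { split; [apply Rinv_0_lt_compat; lra|].
    rewrite <- Rinv_1; apply Rinv_lt_contravar; lra. }
  (* If |F z| > 1, some admissible r exceeds 1 / |F z|, against |F z| <= 1 / r. *)
  set (r := Rmax r0 ((1 + / Cmod (F z)) / 2)).
  assert (Hr : r0 <= r < 1) by (split; [apply Rmax_l|apply Rmax_lub_lt; lra]).
  assert (H2 : / Cmod (F z) < r) by (eapply Rlt_le_trans; [|apply Rmax_r]; lra).
  specialize (Hall r Hr).
  apply Rinv_lt_contravar in H2; [rewrite Rinv_inv in H2; lra|].
  apply Rmult_lt_0_compat; lra. }
rewrite <- (HmF z Hz Hzw).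
generalize (Rmult_le_pos _ _ (Cmod_ge_0 (f z - Cconj (f w))) (Cmod_ge_0 (z - w))); nra.
Qed.

(** * The distance ratio metric *)

(** The neighbourhoods in [boundary] come from [C_UniformSpace]; they agree with those given by
    discs of the modulus. *)
Lemma locally_C_iff (P : C -> Prop) (z : C) :
  @locally C_UniformSpace z P <->
  exists d, 0 < d /\ forall y, Cmod (y - z) < d -> P y.
Proof. rewrite <- Clocally_iff; split; apply (locally_C z P). Qed.

Lemma boundary_upper_half_plane (s : C) : boundary upper_half_plane s <-> Im s = 0.
Proof.
assert (Hnear : forall y d, Cmod (y - s) < d -> Rabs (Im y - Im s) < d).
{ intros y d Hy; destruct (Rabs_le_Cmod (y - s)) as [_ H].
  unfold Cminus in H at 1; rewrite im_plus, im_opp in H; unfold Rminus; lra. }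
assert (Hshift : forall t, Cmod ((s + Ci * RtoC t) - s) = Rabs t).
{ intros t; replace (s + Ci * RtoC t - s)%C with (Ci * RtoC t)%C by ring.
  rewrite Cmod_mult, Cmod_Ci, Cmod_R; ring. }
unfold boundary, upper_half_plane; rewrite !locally_C_iff; split.
- intros [H1 H2]; destruct (Rtotal_order (Im s) 0) as [H|[H|H]]; [|exact H|].
  + elim H2; exists (- Im s); split; [lra|]; intros y Hy.
    apply Hnear, Rabs_def2 in Hy; lra.
  + elim H1; exists (Im s); split; [lra|]; intros y Hy.
    apply Hnear, Rabs_def2 in Hy; lra.
- intros H; split; intros (d & Hd & Hy).
  + specialize (Hy (s + Ci * RtoC (- (d / 2)))%C); rewrite Hshift in Hy.
    rewrite Rabs_Ropp, Rabs_pos_eq in Hy by lra.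
    specialize (Hy ltac:(lra)); simpl in Hy; unfold Im in H; lra.
  + apply (Hy (s + Ci * RtoC (d / 2))%C); [rewrite Hshift, Rabs_pos_eq; lra|].
    simpl; unfold Im in H; lra.
Qed.

Lemma dist_to_boundary_upper_half_plane (z : C) :
  0 < Im z -> dist_to (boundary upper_half_plane) z = Im z.
Proof.
intros Hz; unfold dist_to.
rewrite (is_glb_Rbar_unique _ (Finite (Im z))); [reflexivity|split].
- intros r (s & Hs & ->); apply boundary_upper_half_plane in Hs; simpl.
  destruct (Rabs_le_Cmod (z - s)) as [_ H].
  unfold Cminus in H at 1; rewrite im_plus, im_opp, Hs in H.
  rewrite Rabs_pos_eq in H; lra.
(* The infimum is attained at the foot of the perpendicular from [z] to the real axis. *)
- intros b Hb; apply Hb; exists (RtoC (Re z)); split.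
  + apply boundary_upper_half_plane; reflexivity.
  + replace (z - RtoC (Re z))%C with (Ci * RtoC (Im z))%C
      by (destruct z; apply injective_projections; simpl; ring).
    rewrite Cmod_mult, Cmod_Ci, Cmod_R, Rabs_pos_eq; lra.
Qed.

Lemma distance_ratio_upper_half_plane (z w : C) :
  0 < Im z -> 0 < Im w ->
  distance_ratio upper_half_plane z w = ln (1 + Cmod (z - w) / Rmin (Im z) (Im w)).
Proof.
intros Hz Hw; unfold distance_ratio.
rewrite !dist_to_boundary_upper_half_plane by assumption; reflexivity.
Qed.

(* With [t = d / a] and [t' = d' / a'] the hypotheses give [t'^2 <= t^2 (1 + t')]. *)
Lemma distance_ratio_comparison (a b d a' b' d' : R) :
  0 < a <= b -> 0 < a' -> b' <= a' + d' -> 0 <= d -> 0 <= d' ->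
  d' ^ 2 * (a * b) <= d ^ 2 * (a' * b') ->
  1 + d' / a' <= (1 + d / a) ^ 2.
Proof.
intros Ha Ha' Hb' Hd Hd' H.
set (t := d / a); set (t' := d' / a').
assert (Ht : 0 <= t) by (apply Rdiv_le_0_compat; lra).
assert (Ht' : 0 <= t') by (apply Rdiv_le_0_compat; lra).
replace d with (t * a) in H by (unfold t; field; lra).
replace d' with (t' * a') in H, Hb' by (unfold t'; field; lra).
assert (Hsq : t' ^ 2 <= t ^ 2 * (1 + t')).
{ assert (Hp : 0 < (a * a') ^ 2) by (apply pow_lt, Rmult_lt_0_compat; lra).
  apply Rmult_le_reg_r with ((a * a') ^ 2); [exact Hp|].
  apply Rle_trans with ((t' * a') ^ 2 * (a * b)).
  - replace (t' ^ 2 * (a * a') ^ 2) with ((t' * a') ^ 2 * (a * a)) by ring.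
    apply Rmult_le_compat_l; [apply pow2_ge_0|]; apply Rmult_le_compat_l; lra.
  - eapply Rle_trans; [exact H|].
    replace (t ^ 2 * (1 + t') * (a * a') ^ 2)
      with ((t * a) ^ 2 * (a' * (a' + t' * a'))) by ring.
    apply Rmult_le_compat_l; [apply pow2_ge_0|]; apply Rmult_le_compat_l; lra. }
apply Rnot_lt_le; intros Hlt.
assert (He : 0 < t' - 2 * t - t ^ 2) by (simpl in *; lra).
(* Substituting t' = 2t + t^2 + e turns the inequality into e^2 + (4t + t^2) e + t^2 (3 + 2t) <= 0,
   impossible for e > 0. *)
set (e := t' - 2 * t - t ^ 2) in *.
replace t' with (2 * t + t ^ 2 + e) in Hsq by (unfold e; ring).
assert (0 <= t ^ 2) by apply pow2_ge_0; assert (0 <= t ^ 3) by (apply pow_le; exact Ht).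
assert (0 < e ^ 2) by (apply pow_lt; exact He).
assert (0 <= t * e) by nra; assert (0 <= t ^ 2 * e) by nra.
nra.
Qed.

Lemma distance_ratio_contraction (f : C -> C) (z w : C) :
  holomorphic_map upper_half_plane upper_half_plane f ->
  upper_half_plane z -> upper_half_plane w ->
  distance_ratio upper_half_plane (f z) (f w) <= 2 * distance_ratio upper_half_plane z w.
Proof.
intros [Hf Him] Hz Hw; unfold upper_half_plane in *.
assert (Hfz := Him z Hz); assert (Hfw := Him w Hw).
rewrite !distance_ratio_upper_half_plane by assumption.
assert (SP := schwarz_pick_upper_half_plane f z w
  (fun y Hy => ex_derive_Cdifferentiable f y (Hf y Hy)) Him Hz Hw).
assert (SP2 : (Cmod (f z - f w) * Cmod (z - Cconj w)) ^ 2 <=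
  (Cmod (f z - Cconj (f w)) * Cmod (z - w)) ^ 2)
  by (apply pow_incr; split; [apply Rmult_le_pos; apply Cmod_ge_0|exact SP]).
(* The common term |f z - f w|^2 |z - w|^2 cancels, leaving |f z - f w|^2 Im z Im w <= |z - w|^2 Im
   (f z) Im (f w). *)
rewrite !Rpow_mult_distr, !Cmod_minus_conj_sqr in SP2.
assert (Hmm : forall x y, Rmin x y * Rmax x y = x * y /\ Rmin x y <= Rmax x y).
{ intros x y; unfold Rmin, Rmax; destruct (Rle_dec x y); lra. }
assert (Hm : 0 < Rmin (Im z) (Im w)) by (apply Rmin_pos; assumption).
assert (Hm' : 0 < Rmin (Im (f z)) (Im (f w))) by (apply Rmin_pos; assumption).
destruct (Hmm (Im z) (Im w)) as [E1 L1]; destruct (Hmm (Im (f z)) (Im (f w))) as [E2 _].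
assert (H : 1 + Cmod (f z - f w) / Rmin (Im (f z)) (Im (f w))
  <= (1 + Cmod (z - w) / Rmin (Im z) (Im w)) ^ 2).
{ apply distance_ratio_comparison with (Rmax (Im z) (Im w)) (Rmax (Im (f z)) (Im (f w))).
  - lra.
  - exact Hm'.
  - destruct (Rabs_le_Cmod (f z - f w)) as [_ K].
    unfold Cminus in K at 1; rewrite im_plus, im_opp in K; apply Rabs_le_between in K.
    unfold Rmin, Rmax; destruct (Rle_dec (Im (f z)) (Im (f w))); lra.
  - apply Cmod_ge_0.
  - apply Cmod_ge_0.
  - rewrite E1, E2; nra. }
assert (0 <= Cmod (z - w) / Rmin (Im z) (Im w))
  by (apply Rdiv_le_0_compat; [apply Cmod_ge_0|assumption]).
assert (0 <= Cmod (f z - f w) / Rmin (Im (f z)) (Im (f w)))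
  by (apply Rdiv_le_0_compat; [apply Cmod_ge_0|assumption]).
(* The square becomes the factor 2 under the logarithm. *)
change 2 with (INR 2); rewrite <- ln_pow by lra.
apply ln_le; [lra|exact H].
Qed.

(** * Sharpness of the constant 2 *)

Definition neg_inv (u : C) : C := (- / u)%C.

Lemma im_neg_inv (u : C) : Im (neg_inv u) = Im u / (Re u ^ 2 + Im u ^ 2).
Proof. unfold neg_inv, Re, Im; simpl; unfold Rdiv; ring. Qed.

Lemma holomorphic_neg_inv : holomorphic_map upper_half_plane upper_half_plane neg_inv.
Proof.
unfold upper_half_plane; split.
- intros z Hz; apply Cdifferentiable_ex_derive.
  apply (@ex_derive_opp C_AbsRing (AbsRing_NormedModule C_AbsRing) Cinv z).
  apply Cdifferentiable_inv; intros ->; simpl in Hz; lra.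
- intros z Hz; rewrite im_neg_inv; apply Rdiv_lt_0_compat; [exact Hz|].
  generalize (pow2_ge_0 (Re z)) (pow_lt _ 2 Hz); lra.
Qed.

(** For z = i and w = - T + i the distance is ln (1 + T), while that of the images is at least ln (1
    + T^2) >= 2 ln (1 + T) - ln 2. The loss ln 2 is bounded, so a large T defeats any c < 2. *)
Lemma distance_ratio_sharp (c : R) :
  c < 2 ->
  exists z w, upper_half_plane z /\ upper_half_plane w /\
    c * distance_ratio upper_half_plane z w <
    distance_ratio upper_half_plane (neg_inv z) (neg_inv w).
Proof.
(* [L] is to be the distance from z to w; then (2 - c) L = 2 exceeds the loss ln 2. *)
intros Hc; set (L := 2 / (2 - c)).
assert (HL : 0 < L) by (apply Rdiv_lt_0_compat; lra).
assert (HcL : c * L = 2 * L - 2) by (unfold L; field; lra).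
set (T := exp L - 1).
assert (HT : 0 < T) by (unfold T; generalize (exp_ineq1_le L); lra).
pose (w := (- T, 1) : C).
assert (Rei : Re Ci = 0) by reflexivity; assert (Imi : Im Ci = 1) by reflexivity.
assert (Rew : Re w = - T) by reflexivity; assert (Imw : Im w = 1) by reflexivity.
exists Ci, w; unfold upper_half_plane; rewrite Imi, Imw.
split; [lra|]; split; [lra|].
destruct holomorphic_neg_inv as [_ Hup]; unfold upper_half_plane in Hup.
rewrite !distance_ratio_upper_half_plane by (try apply Hup; lra).
rewrite Imi, Imw, Rmin_left by lra.
replace (Cmod (Ci - w)) with T.
2: { replace (Ci - w)%C with (RtoC T)
       by (apply injective_projections; simpl; ring).
     rewrite Cmod_R, Rabs_pos_eq; lra. }
replace (1 + T / 1) with (exp L) by (unfold T; field).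
rewrite ln_exp, HcL, !im_neg_inv, Rei, Imi, Rew, Imw.
replace (1 / (0 ^ 2 + 1 ^ 2)) with 1 by field.
replace ((- T) ^ 2 + 1 ^ 2) with (1 + T ^ 2) by ring.
assert (HT2 : 0 < T ^ 2) by (apply pow_lt; exact HT).
assert (Hs : 1 / (1 + T ^ 2) <= 1).
{ apply Rmult_le_reg_r with (1 + T ^ 2); [lra|].
  unfold Rdiv; rewrite Rmult_assoc, Rinv_l; lra. }
rewrite Rmin_right by exact Hs.
(* The imaginary parts of the images are 1 and 1 / (1 + T^2); their difference, divided by the
   smaller one, is already T^2. *)
assert (Hk : 1 - 1 / (1 + T ^ 2) <= Cmod (neg_inv Ci - neg_inv w)).
{ destruct (Rabs_le_Cmod (neg_inv Ci - neg_inv w)) as [_ K].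
  unfold Cminus in K at 1; rewrite im_plus, im_opp, !im_neg_inv, Rei, Imi, Rew, Imw in K.
  replace (1 / (0 ^ 2 + 1 ^ 2)) with 1 in K by field.
  replace ((- T) ^ 2 + 1 ^ 2) with (1 + T ^ 2) in K by ring.
  rewrite Rabs_pos_eq in K; lra. }
set (k := Cmod (neg_inv Ci - neg_inv w)) in *.
assert (Hbig : T ^ 2 <= k / (1 / (1 + T ^ 2))).
{ replace (k / (1 / (1 + T ^ 2))) with (k * (1 + T ^ 2)) by (field; lra).
  replace (T ^ 2) with ((1 - 1 / (1 + T ^ 2)) * (1 + T ^ 2)) at 1 by (field; lra).
  apply Rmult_le_compat_r; lra. }
apply Rlt_le_trans with (ln (1 + T ^ 2)); [|apply ln_le; lra].
(* (1 + T)^2 <= 2 (1 + T^2) *)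
assert (H2 : 2 * L <= ln 2 + ln (1 + T ^ 2)).
{ rewrite <- ln_mult by lra.
  replace (2 * L) with (ln (exp L ^ 2))
    by (rewrite ln_pow by apply exp_pos; rewrite ln_exp; simpl; ring).
  apply ln_le; [apply pow_lt, exp_pos|].
  replace (exp L) with (1 + T) by (unfold T; ring).
  generalize (pow2_ge_0 (1 - T)); simpl; lra. }
assert (ln 2 <= 1).
{ rewrite <- (ln_exp 1); apply ln_le; [lra|]; generalize (exp_ineq1_le 1); lra. }
lra.
Qed.

Theorem theorem1 :
  (forall f : C -> C, holomorphic_map upper_half_plane upper_half_plane f ->
   forall z w : C, upper_half_plane z -> upper_half_plane w ->
     distance_ratio upper_half_plane (f z) (f w)
       <= 2 * distance_ratio upper_half_plane z w) /\
  ~ (exists c : R, c < 2 /\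
     forall f : C -> C, holomorphic_map upper_half_plane upper_half_plane f ->
     forall z w : C, upper_half_plane z -> upper_half_plane w ->
       distance_ratio upper_half_plane (f z) (f w)
         <= c * distance_ratio upper_half_plane z w).
Proof.
split.
- intros f Hf z w Hz Hw; apply distance_ratio_contraction; assumption.
- intros (c & Hc & H).
  destruct (distance_ratio_sharp c Hc) as (z & w & Hz & Hw & Hlt).
  specialize (H neg_inv holomorphic_neg_inv z w Hz Hw); lra.
Qed.
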